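(* Let $\mathfrak g=\mathbb R e_7\ltimes_A\mathfrak h$ be a seven-dimensional almost-abelian Lie algebra endowed with a coclosed $G_2$-structure $\varphi_0$, where $e_7$ is a unit vector $g_{\varphi_0}$-orthogonal to the codimension-one abelian ideal $\mathfrak h$ and $A=\mathrm{ad}_{e_7}|_{\mathfrak h}$. Let $(\omega_0,\psi_0)$ be the induced $\mathrm{SU}(3)$-structure on $\mathfrak h$, with complex structure $J_0$ and inner product $h_0=g_{\varphi_0}|_{\mathfrak h}$. Suppose that $A$ is skew-symmetric with respect to $h_0$, and let $l=l_1+l_2+l_3$, where $l_1,l_2,l_3\in\mathbb R$ are such that, for some adapted frame $(e_1,J_0e_1,e_2,J_0e_2,e_3,J_0e_3)$ of $(\mathfrak h,\omega_0,\psi_0)$, $Ae_j=l_jJ_0e_j$ and $AJ_0e_j=-l_je_j$ for $j=1,2,3$. Then the solution $p_t$ of $$\dot p_t=-\varepsilon(p_t)^2\,\vartheta(A)\vartheta(B_t)p_t,\qquad p_0=\psi_0,$$ is given by $$p_t=b(t)\psi_0,\qquad b(t)=e^{-l^2\int_0^t\varepsilon_u^2\,du},\qquad \varepsilon_t=\frac{1}{\sqrt{1-2l^2t}}.$$ In particular, $p_t$ is an ancient solution, defined for every $t\in\left(-\infty,\frac{1}{2l^2}\right)$ (the end-point being read as $+\infty$ if $l=0$).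
   Context: Almost-abelian: $\mathfrak g=\mathbb R e_7\ltimes_A\mathfrak h$ has a codimension-one abelian ideal $\mathfrak h$ and $[e_7,v]=Av$ for $v\in\mathfrak h$. A $G_2$-structure on a 7-dimensional Lie algebra $\mathfrak g$ is a 3-form $\varphi$ which in some coframe $(e^1,\dots,e^7)$ is $\varphi=e^{127}+e^{347}+e^{567}+e^{135}-e^{146}-e^{236}-e^{245}$; it determines the metric $g_\varphi$ and orientation for which this coframe is orthonormal and positive, and the dual 4-form is $\phi=\star_\varphi\varphi=e^{1234}+e^{3456}+e^{1256}-e^{2467}+e^{1367}+e^{1457}+e^{2357}$. It is coclosed if $d\phi=0$, $d$ being the Chevalley–Eilenberg differential. A (normalized) $\mathrm{SU}(3)$-structure on a 6-dimensional real vector space is a pair $(\omega,\psi)$ of a 2-form and a 3-form for which there is a basis $(f_1,\dots,f_6)$, called an adapted frame, with dual basis $(f^i)$ such that $\omega=f^{12}+f^{34}+f^{56}$ and $\psi=-f^{246}+f^{136}+f^{145}+f^{235}$. The induced complex structure is $J f_{2k-1}=f_{2k}$, $Jf_{2k}=-f_{2k-1}$, and the induced inner product $h(x,y)=\omega(x,Jy)$ makes the frame orthonormal. Induced $\mathrm{SU}(3)$-structure on $\mathfrak h$: with $\phi_0=\star_{\varphi_0}\varphi_0$, $\omega_0$ and $\psi_0$ are the restrictions to $\mathfrak h$ of the contractions of $e_7$ with $\varphi_0$ and $-\phi_0$ respectively. Coclosedness is equivalent to $A\in\mathfrak{sp}(\mathfrak h,\omega_0)$; when $A$ is moreover skew-symmetric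 it commutes with $J_0$, and an adapted frame and numbers $l_j$ as in the statement exist. $\vartheta$ is the action of endomorphisms on forms: $\vartheta(A)\alpha=-\alpha\circ A$ on 1-forms, extended as a derivation of the exterior algebra. In the evolution equation, $p_t$ is a time-dependent 3-form on $\mathfrak h$; $\varepsilon(p_t)>0$ is the number such that $(\omega_0,\varepsilon(p_t)p_t)$ is a normalized $\mathrm{SU}(3)$-structure on $\mathfrak h$, and $B_t$ is the adjoint of $A$ with respect to the inner product $h_t$ on $\mathfrak h$ induced by $(\omega_0,\varepsilon(p_t)p_t)$. (This equation is the Laplacian coflow $\dot\phi_t=-\Delta_t\phi_t$, $d\phi_t=0$, for $\phi_t=\frac12\omega_0^2+p_t\wedge\eta$, where $\eta$ is the 1-form with $\eta(e_7)=1$, $\eta|_{\mathfrak h}=0$.) A solution is ancient if it is defined on some interval $(-\infty,T)$ with $0<T<+\infty$. *)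

(* Defs.v *)
From mathcomp Require Export all_boot all_order all_algebra.
From mathcomp Require Export all_classical all_reals all_analysis.
Export Order.TTheory GRing.Theory Num.Theory.
Export numFieldNormedType.Exports.

#[export] Set Implicit Arguments.
#[export] Unset Strict Implicit.
#[export] Unset Printing Implicit Defensive.

Local Open Scope classical_set_scope.
Local Open Scope ring_scope.

(* A k-form on V is a function of k vectors.  The type does not impose
   multilinearity or alternation: every form below is either built from the
   monomials [mono] or required to equal an explicit combination of them. *)
Definition form (R : realType) (V : vectType R) (k : nat) : Type :=
  ('I_k -> V) -> R^o.

Section Forms.
Context {R : realType} {V : vectType R}.

(* [mono X [tuple i1; ...; ik]] is e^{i1 ... ik} = e^{i1} /\ ... /\ e^{ik},
   where (e^1, ..., e^n) is the dual basis of X.  Indices start at 1. *)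
Definition mono n k (X : n.+1.-tuple V) (s : k.-tuple nat) : form V k :=
  fun v => \det (\matrix_(a < k, b < k) coord X (inord (tnth s a).-1) (v b)).

Definition contract k (x : V) (a : form V k.+1) : form V k :=
  fun v => a (fun i => if unlift ord0 i is Some j then v j else x).

Definition form_restr k (U : {vspace V}) (a : form V k) : form (subvs_of U) k :=
  fun v => a (fun i => vsval (v i)).

(* The derivation of the exterior algebra that is -(a \o A) on 1-forms a. *)
Definition vartheta k (A : 'End(V)) (a : form V k) : form V k :=
  fun v => - \sum_(i < k) a (fun j => if j == i then A (v j) else v j).

Definition is_lie_bracket (br : V -> V -> V) : Prop :=
  [/\ forall x, linear (br x),
      forall y, linear (br^~ y),
      forall x, br x x = 0 &
      forall x y z, br x (br y z) + br y (br z x) + br z (br x y) = 0].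

(* Chevalley-Eilenberg differential:
   da(x_0, ..., x_k) =
     \sum_(i < j) (-1)^(i+j) a([x_i, x_j], x_0, ..^x_i..^x_j.., x_k). *)
Definition CE_diff (br : V -> V -> V) k (a : form V k) : form V k.+1 :=
  fun x => \sum_(i < k.+1) \sum_(j < k.+1 | (i < j)%N)
    (-1) ^+ (i + j) *
    a (fun n : 'I_k =>
         nth 0 (br (x i) (x j) ::
                [seq x m | m <- enum 'I_k.+1 & (m != i) && (m != j)]) n).

(* V = R e7 |x_A h: h is an abelian ideal of codimension one, e7 spans a
   complement, and A = ad_{e7}|_h. *)
Definition almost_abelian (br : V -> V -> V) (e7 : V) (h : {vspace V})
    (A : 'End(subvs_of h)) : Prop :=
  [/\ is_lie_bracket br,
      e7 \notin h /\ \dim (fullv : {vspace V}) = (\dim h).+1,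
      forall x v, v \in h -> br x v \in h,
      forall u v, u \in h -> v \in h -> br u v = 0 &
      forall v : subvs_of h, vsval (A v) = br e7 (vsval v)].

(* phi is a G2-structure, g its metric and dphi its dual 4-form (these two do
   not depend on the adapted basis X). *)
Definition G2_structure (phi : form V 3) (g : V -> V -> R) (dphi : form V 4)
    : Prop :=
  exists X : 7.-tuple V,
    [/\ basis_of fullv X,
        phi = mono X [tuple 1; 2; 7]%N + mono X [tuple 3; 4; 7]%N
            + mono X [tuple 5; 6; 7]%N + mono X [tuple 1; 3; 5]%N
            - mono X [tuple 1; 4; 6]%N - mono X [tuple 2; 3; 6]%N
            - mono X [tuple 2; 4; 5]%N,
        (forall x y, g x y = \sum_(i < 7) coord X i x * coord X i y) &
        dphi = mono X [tuple 1; 2; 3; 4]%N + mono X [tuple 3; 4; 5; 6]%N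
             + mono X [tuple 1; 2; 5; 6]%N - mono X [tuple 2; 4; 6; 7]%N
             + mono X [tuple 1; 3; 6; 7]%N + mono X [tuple 1; 4; 5; 7]%N
             + mono X [tuple 2; 3; 5; 7]%N].

Definition SU3_adapted (omega : form V 2) (psi : form V 3) (F : 6.-tuple V)
    : Prop :=
  [/\ basis_of fullv F,
      omega = mono F [tuple 1; 2]%N + mono F [tuple 3; 4]%N + mono F [tuple 5; 6]%N &
      psi = - mono F [tuple 2; 4; 6]%N + mono F [tuple 1; 3; 6]%N
          + mono F [tuple 1; 4; 5]%N + mono F [tuple 2; 3; 5]%N].

(* (omega, psi) is a normalized SU(3)-structure with complex structure J
   (which does not depend on the adapted frame). *)
Definition SU3_structure (omega : form V 2) (psi : form V 3) (J : 'End(V))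
    : Prop :=
  exists f1 f2 f3 f4 f5 f6 : V,
    [/\ SU3_adapted omega psi [tuple f1; f2; f3; f4; f5; f6],
        J f1 = f2 /\ J f2 = - f1,
        J f3 = f4 /\ J f4 = - f3 &
        J f5 = f6 /\ J f6 = - f5].

Definition SU3_metric (omega : form V 2) (J : 'End(V)) (x y : V) : R :=
  omega (tnth [tuple x; J y]).

Definition adjoint_wrt (h : V -> V -> R) (A B : 'End(V)) : Prop :=
  forall x y, h (A x) y = h x (B y).

(* p solves, on the open interval I containing 0,
     p' = - eps(p)^2 vartheta(A) vartheta(B) p,    p(0) = psi0,
   with eps t = eps(p_t).  The derivative of the form-valued map p is taken
   pointwise, i.e. on each triple of vectors. *)
Definition coflow_solution (A : 'End(V)) (omega0 : form V 2) (psi0 : form V 3)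
    (I : set R) (p : R -> form V 3) (eps : R -> R) : Prop :=
  [/\ open I, is_interval I, I 0, p 0 = psi0 &
      forall t, I t ->
        0 < eps t /\
        exists J B : 'End(V),
          [/\ SU3_structure omega0 (eps t *: p t) J,
              adjoint_wrt (SU3_metric omega0 J) A B &
              forall v : 'I_3 -> V,
                is_derive t 1 (fun s => p s v)
                  (- (eps t) ^+ 2 * vartheta A (vartheta B (p t)) v)]].

Definition ancient_solution (A : 'End(V)) (omega0 : form V 2)
    (psi0 : form V 3) (p : R -> form V 3) (eps : R -> R) : Prop :=
  exists2 T : R, 0 < T & coflow_solution A omega0 psi0 [set t | t < T] p eps.

End Forms.

Arguments form_restr {R V k} U a _.

Section RealFunctions.
Context {R : realType}.

(* The integral from a to b with the usual sign convention when b < a. *)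
Definition oint (a b : R) (f : R -> R) : R :=
  if a <= b then Rintegral lebesgue_measure `[a, b] f
  else - Rintegral lebesgue_measure `[b, a] f.

Definition lifetime (l : R) : \bar R :=
  if l == 0 then +oo%E else ((2 * l ^+ 2)^-1)%:E.

Definition eps_sol (l t : R) : R := (Num.sqrt (1 - 2 * l ^+ 2 * t))^-1.

Definition b_sol (l t : R) : R :=
  expR (- l ^+ 2 * oint 0 t (fun u => eps_sol l u ^+ 2)).

End RealFunctions.

(* Main.v *)
Require Import Defs.
From mathcomp Require Import ring lra.
Local Open Scope classical_set_scope.
Local Open Scope ring_scope.

(* Since A = l_j J_0 on the j-th complex line and psi_0 is the imaginary part of
   a complex volume form, A acts on psi_0 through its complex trace l, so
   vartheta(A) vartheta(-A) psi_0 = l^2 psi_0, and the ansatz p = b psi_0 with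
   eps = 1/b reduces the equation to b' = - l^2 / b.

   For uniqueness, an SU(3)-structure (om, rho) has metric
   h(x, y) = - 1/4 sum_(a, b) rho(x, f_a, f_b) rho(y, J f_a, J f_b), and because
   sum_a f_a (x) J f_a is the inverse of om this sum may be taken over a fixed
   om-unitary frame.  With rho = eps p, the complex structure is therefore
   eps^2 times a quadratic polynomial in p; J^2 = -1 makes eps^(-4) a quartic
   polynomial in p; and B = J A J.  Hence p solves an ordinary differential
   equation whose right-hand side is a polynomial in p times a negative power of
   that quartic, and Gronwall's inequality applies.  A solution cannot reach
   1 / (2 l^2), since there p would vanish. *)

(** * A Gronwall argument *)

Section Gronwall.
Context {R : realType}.

(** To the right of 0 the function D e^(-Ct) is nonincreasing, to the left D e^(Ct) is
    nondecreasing. Both vanish at 0, so D <= 0 on either side. The interval is two-sided because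
    solutions extend to negative times. *)
Lemma gronwall_eq0 (D D' : R -> R) (C a b : R) : a <= 0 <= b ->
  (forall t, a <= t <= b -> is_derive t 1 D (D' t)) ->
  (forall t, a <= t <= b -> `|D' t| <= C * D t) ->
  (forall t, 0 <= D t) -> D 0 = 0 ->
  forall t, a <= t <= b -> D t = 0.
Proof.
move=> /andP[a0 b0] dD D'le D0 D00 t /andP[a_t t_b].
have dE (s k : R) : is_derive s 1 (fun s : R => expR (k * s)) (k * expR (k * s)).
  apply: is_derive_eq; rewrite /GRing.scale /=; ring.
have dF (s k : R) : a <= s <= b ->
    is_derive s 1 (fun s : R => D s * expR (k * s))
      ((D' s + k * D s) * expR (k * s)).
  move=> sab; have ? := dD s sab; have ? := dE s k.
  by apply: is_derive_eq; rewrite /GRing.scale /=; ring.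
apply/eqP; rewrite eq_le D0 andbT.
case: (leP 0 t) => t0.
- suff : D t * expR (- C * t) <= D 0 * expR (- C * 0).
    by rewrite D00 mul0r pmulr_lle0 ?expR_gt0.
  have sab s : 0 <= s <= t -> a <= s <= b.
    by move=> /andP[? ?]; rewrite (le_trans a0)//= (le_trans _ t_b).
  apply: (@ler0_derive1_nincr _ (fun s => D s * expR (- C * s)) 0 t) => //.
  + move=> s; rewrite in_itv /= => /andP[/ltW s0 /ltW st].
    by apply: ex_derive; apply: dF; rewrite sab ?s0.
  + move=> s; rewrite in_itv /= => /andP[/ltW s0 /ltW st].
    rewrite derive1E (derive_val (is_derive := dF s (- C) _)) ?sab ?s0//.
    rewrite pmulr_lle0 ?expR_gt0// mulNr subr_le0.
    by rewrite (le_trans (ler_norm _))// D'le// sab// s0.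
  + apply: derivable_within_continuous => s; rewrite in_itv /= => st.
    by apply: ex_derive; apply: dF; exact: sab.
- suff : D t * expR (C * t) <= D 0 * expR (C * 0).
    by rewrite D00 mul0r pmulr_lle0 ?expR_gt0.
  have sab s : t <= s <= 0 -> a <= s <= b.
    by move=> /andP[? ?]; rewrite (le_trans a_t)//= (le_trans _ b0).
  apply: (@ger0_derive1_ndecr _ (fun s => D s * expR (C * s)) t 0) => //; last exact: ltW.
  + move=> s; rewrite in_itv /= => /andP[/ltW s0 /ltW st].
    by apply: ex_derive; apply: dF; rewrite sab ?s0.
  + move=> s; rewrite in_itv /= => /andP[/ltW s0 /ltW st].
    rewrite derive1E (derive_val (is_derive := dF s C _)) ?sab ?s0//.
    rewrite mulr_ge0 ?expR_ge0// addrC -lerBlDr sub0r.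
    have : - D' s <= `|D' s| by rewrite -normrN ler_norm.
    by move=> /le_trans -> //; rewrite D'le// sab// s0.
  + apply: derivable_within_continuous => s; rewrite in_itv /= => st.
    by apply: ex_derive; apply: dF; exact: sab.
Qed.

End Gronwall.

(** * Functions controlled by the distance between two solutions *)

Section ModulusClass.
Context {R : realType} (a b : R) (d : R -> R).
Hypothesis d_ge0 : forall t, 0 <= d t.
Implicit Types f g : R -> R.

(* Every function occurring in the flow equation lies in this class, evaluated
   along two solutions whose distance at time t is d t. *)
Definition lipclose f g : Prop :=
  [/\ forall t, a <= t <= b -> {for t, continuous f},
      forall t, a <= t <= b -> {for t, continuous g} &
      exists2 C : R, 0 <= C & forall t, a <= t <= b ->
        [/\ `|f t| <= C, `|g t| <= C & `|f t - g t| <= C * d t]].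

Lemma lipclose_cst c : lipclose (cst c) (cst c).
Proof.
split=> [t _|t _|]; [exact: cst_continuous|exact: cst_continuous|].
by exists `|c| => // t _; split=> //; rewrite subrr normr0 mulr_ge0.
Qed.

Lemma lipcloseD f1 g1 f2 g2 : lipclose f1 g1 -> lipclose f2 g2 ->
  lipclose (fun t => f1 t + f2 t) (fun t => g1 t + g2 t).
Proof.
move=> [cf1 cg1 [C1 C10 h1]] [cf2 cg2 [C2 C20 h2]].
split=> [t tab|t tab|].
- by apply: cvgD; [exact: cf1|exact: cf2].
- by apply: cvgD; [exact: cg1|exact: cg2].
exists (C1 + C2); first exact: addr_ge0.
move=> t tab; have [? ? ?] := h1 t tab; have [? ? ?] := h2 t tab.
split; try by rewrite (le_trans (ler_normD _ _))// lerD.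
rewrite (_ : _ - _ = (f1 t - g1 t) + (f2 t - g2 t)); last by ring.
by rewrite (le_trans (ler_normD _ _))// mulrDl lerD.
Qed.

(** The uniform bounds in [lipclose] serve this rule: they turn differences of factors into a
    difference of products. *)
Lemma lipcloseM f1 g1 f2 g2 : lipclose f1 g1 -> lipclose f2 g2 ->
  lipclose (fun t => f1 t * f2 t) (fun t => g1 t * g2 t).
Proof.
move=> [cf1 cg1 [C1 C10 h1]] [cf2 cg2 [C2 C20 h2]].
split=> [t tab|t tab|].
- by apply: cvgM; [exact: cf1|exact: cf2].
- by apply: cvgM; [exact: cg1|exact: cg2].
exists (C1 * C2 + C1 * C2); first by rewrite addr_ge0 ?mulr_ge0.
move=> t tab; have [? ? ?] := h1 t tab; have [? ? ?] := h2 t tab.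
have C12 : C1 * C2 <= C1 * C2 + C1 * C2 by rewrite lerDl mulr_ge0.
split; try by rewrite normrM (le_trans _ C12)// ler_pM.
rewrite (_ : _ - _ = f1 t * (f2 t - g2 t) + (f1 t - g1 t) * g2 t); last by ring.
rewrite (le_trans (ler_normD _ _))// [leRHS]mulrDl !normrM lerD//.
  by rewrite -mulrA ler_pM.
by rewrite mulrAC ler_pM.
Qed.

Lemma lipcloseN f g : lipclose f g -> lipclose (fun t => - f t) (fun t => - g t).
Proof.
move=> fg; have := lipcloseM (lipclose_cst (-1)) fg; congr lipclose;
by apply/funext => t; rewrite mulN1r.
Qed.

Lemma lipclose_sum (I : Type) (r : seq I) (P : pred I) (f g : I -> R -> R) :
  (forall i, P i -> lipclose (f i) (g i)) ->
  lipclose (fun t => \sum_(i <- r | P i) f i t) (fun t => \sum_(i <- r | P i) g i t).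
Proof.
move=> fg; elim: r => [|i r IH].
  by have := lipclose_cst 0; congr lipclose; apply/funext => t; rewrite big_nil.
under [X in lipclose X _]funext do rewrite big_cons.
under [X in lipclose _ X]funext do rewrite big_cons.
by case Pi : (P i) => //; apply: lipcloseD => //; exact: fg.
Qed.

(** A positive continuous function on a compact interval is bounded away from 0, so both reciprocals
    are bounded, and 1/f - 1/g = - (f - g) / (f g). *)
Lemma lipcloseV f g : a <= b -> lipclose f g ->
  (forall t, a <= t <= b -> 0 < f t) -> (forall t, a <= t <= b -> 0 < g t) ->
  lipclose (fun t => (f t)^-1) (fun t => (g t)^-1).
Proof.
move=> ab [cf cg [C C0 h]] f0 g0.
have bnd (k : R -> R) : (forall t, a <= t <= b -> {for t, continuous k}) ->
    (forall t, a <= t <= b -> 0 < k t) ->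
    exists2 M, 0 < M & forall t, a <= t <= b -> `|(k t)^-1| <= M.
  move=> ck k0.
  have /(EVT_min ab)[c] : {within `[a, b], continuous k}.
    by apply: continuous_in_subspaceT => t; rewrite inE /= in_itv /= => /ck.
  rewrite in_itv /= => cab kc; exists (k c)^-1; first by rewrite invr_gt0 k0.
  move=> t tab; rewrite ger0_norm ?invr_ge0 ?(ltW (k0 _ _))//.
  by rewrite lef_pV2 ?posrE ?k0// kc// in_itv.
have [M M0 fM] := bnd f cf f0; have [N N0 gN] := bnd g cg g0.
split=> [t tab|t tab|].
- by apply: cvgV; [rewrite gt_eqF// f0|exact: cf].
- by apply: cvgV; [rewrite gt_eqF// g0|exact: cg].
have MNC : 0 <= M * N * C by rewrite !mulr_ge0// ltW.
exists (M + N + M * N * C); first by rewrite !addr_ge0// ltW.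
move=> t tab; have [_ _ fgt] := h t tab; split.
- by rewrite (le_trans (fM t tab))// -addrA lerDl addr_ge0// ltW.
- by rewrite (le_trans (gN t tab))// addrAC lerDr addr_ge0// ltW.
have fn : f t != 0 by rewrite gt_eqF// f0.
have gn : g t != 0 by rewrite gt_eqF// g0.
rewrite (_ : _ - _ = - ((f t)^-1 * (g t)^-1 * (f t - g t))); last by field; rewrite fn gn.
rewrite normrN !normrM.
have : `|(f t)^-1| * `|(g t)^-1| * `|f t - g t| <= M * N * (C * d t).
  by rewrite ler_pM ?mulr_ge0// ler_pM ?fM ?gN.
move=> /le_trans -> //; rewrite mulrA ler_wpM2r// lerDr.
by rewrite addr_ge0// ltW.
Qed.

(** The difference of the roots is (f - g) / (sqrt f + sqrt g), whose denominator is at least sqrt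
    f. *)
Lemma lipclose_sqrt f g : a <= b -> lipclose f g ->
  (forall t, a <= t <= b -> 0 < f t) -> (forall t, a <= t <= b -> 0 < g t) ->
  lipclose (fun t => Num.sqrt (f t)) (fun t => Num.sqrt (g t)).
Proof.
move=> ab fg f0 g0; have [cf cg [C C0 h]] := fg.
have cs (k : R -> R) t : {for t, continuous k} -> {for t, continuous (fun t => Num.sqrt (k t))}.
  by move=> ck; apply: continuous_comp ck _; exact: sqrt_continuous.
(* Only the lower bound on f is needed, and it comes from lipcloseV applied to sqrt f. *)
have [_ _ [M M0 hM]] : lipclose (fun t => (Num.sqrt (f t))^-1) (fun t => (Num.sqrt (f t))^-1).
  apply: lipcloseV => //; try by move=> t tab; rewrite sqrtr_gt0 f0.
  split=> [t tab|t tab|]; [exact/cs/cf|exact/cs/cf|].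
  exists (1 + C); first by rewrite addr_ge0.
  move=> t tab; have [ft _ _] := h t tab.
  (* With s the root, s <= 1 + s ^ 2 <= 1 + C. *)
  have sf : `|Num.sqrt (f t)| <= 1 + C.
    rewrite ger0_norm ?sqrtr_ge0//.
    have := sqr_sqrtr (ltW (f0 t tab)); have := sqrtr_ge0 (f t).
    have := le_trans (ler_norm _) ft.
    by move: (Num.sqrt _) => s; nra.
  by split=> //; rewrite subrr normr0 mulr_ge0// addr_ge0.
split=> [t tab|t tab|]; [exact/cs/cf|exact/cs/cg|].
exists (1 + C + M * C); first by rewrite !addr_ge0// mulr_ge0.
move=> t tab; have [ft gt fgt] := h t tab; have [Mt _ _] := hM t tab.
have sq x : 0 < x -> `|x| <= C -> `|Num.sqrt x| <= 1 + C + M * C.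
  move=> x0 xC; rewrite ger0_norm ?sqrtr_ge0//.
  have := sqr_sqrtr (ltW x0); have := sqrtr_ge0 x.
  have := le_trans (ler_norm _) xC; have := mulr_ge0 M0 C0.
  by move: (Num.sqrt _) => s; nra.
split; [by apply: sq => //; exact: f0|by apply: sq => //; exact: g0|].
have sf0 : 0 < Num.sqrt (f t) by rewrite sqrtr_gt0 f0.
have sg0 : 0 < Num.sqrt (g t) by rewrite sqrtr_gt0 g0.
have key : `|Num.sqrt (f t) - Num.sqrt (g t)| * Num.sqrt (f t) <= `|f t - g t|.
  have -> : f t - g t = (Num.sqrt (f t) - Num.sqrt (g t)) * (Num.sqrt (f t) + Num.sqrt (g t)).
    by rewrite -subr_sqr !sqr_sqrtr// ltW ?f0 ?g0.
  by rewrite normrM ler_wpM2l// ger0_norm ?lerDl ltW// addr_gt0.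
have : `|Num.sqrt (f t) - Num.sqrt (g t)| <= C * d t * M.
  rewrite -[leLHS](mulfK (lt0r_neq0 sf0)) ler_pM ?mulr_ge0 ?invr_ge0 ?(ltW sf0)//.
    exact: le_trans key fgt.
  exact: le_trans (ler_norm _) Mt.
move=> /le_trans -> //; rewrite mulrAC [C * M]mulrC ler_wpM2r// lerDr.
by rewrite addr_ge0.
Qed.

End ModulusClass.

(** * Unitary frames and adapted frames *)

Lemma det_mx22 (R : comNzRingType) (M : 'M[R]_2) :
  \det M = M 0 0 * M 1 1 - M 0 1 * M 1 0.
Proof.
rewrite (expand_det_row _ 0) !big_ord_recl big_ord0 /cofactor !det_mx11 !mxE.
have -> : lift (0 : 'I_2) (0 : 'I_1) = 1 by apply: val_inj.
have -> : lift (1 : 'I_2) (0 : 'I_1) = 0 by apply: val_inj.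
by rewrite /= /bump /= addn0 add0n !expr0 expr1; ring.
Qed.

Lemma det_mx33 (R : comNzRingType) (M : 'M[R]_3) :
  \det M =
    M 0 0 * (M 1 1 * M ord_max ord_max - M 1 ord_max * M ord_max 1)
  - M 0 1 * (M 1 0 * M ord_max ord_max - M 1 ord_max * M ord_max 0)
  + M 0 ord_max * (M 1 0 * M ord_max 1 - M 1 1 * M ord_max 0).
Proof.
rewrite (expand_det_row _ 0) !big_ord_recl big_ord0 /cofactor !det_mx22 !mxE.
have -> : lift (0 : 'I_3) (lift (0 : 'I_2) (0 : 'I_1)) = ord_max by apply: val_inj.
have -> : lift (0 : 'I_3) (0 : 'I_2) = 1 by apply: val_inj.
have -> : lift (0 : 'I_3) (1 : 'I_2) = ord_max by apply: val_inj.
have -> : lift (1 : 'I_3) (0 : 'I_2) = 0 by apply: val_inj.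
have -> : lift (1 : 'I_3) (1 : 'I_2) = ord_max by apply: val_inj.
have -> : lift (ord_max : 'I_3) (0 : 'I_2) = 0 by apply: val_inj.
have -> : lift (ord_max : 'I_3) (1 : 'I_2) = 1 by apply: val_inj.
have -> : (0 + (ord_max : 'I_3) = 2)%N by [].
by rewrite addn0 add0n expr0 expr1 expr2; ring.
Qed.

Section Monomials.
Context {R : realType} {V : vectType R} (n : nat) (X : n.+1.-tuple V).
Local Notation c k := (coord X (inord k)).

Lemma mono2E i j (x y : V) :
  mono X [tuple i; j] (tnth [tuple x; y]) =
    c i.-1 x * c j.-1 y - c i.-1 y * c j.-1 x.
Proof. by rewrite /mono det_mx22 !mxE. Qed.

Lemma mono3E i j k (x y z : V) :
  mono X [tuple i; j; k] (tnth [tuple x; y; z]) =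
    c i.-1 x * (c j.-1 y * c k.-1 z - c j.-1 z * c k.-1 y)
  - c i.-1 y * (c j.-1 x * c k.-1 z - c j.-1 z * c k.-1 x)
  + c i.-1 z * (c j.-1 x * c k.-1 y - c j.-1 y * c k.-1 x).
Proof. by rewrite /mono det_mx33 !mxE. Qed.

End Monomials.

Section Frames.
Context {R : realType} {V : vectType R}.
Implicit Types (J : 'End(V)) (F : 'I_6 -> V).

Lemma scalar_sum (L : V -> R) (I : Type) (r : seq I) (k : I -> R) (x : I -> V) :
  scalar L -> L (\sum_(i <- r) k i *: x i) = \sum_(i <- r) k i * L (x i).
Proof.
move=> hL; elim: r => [|i r IH]; last by rewrite !big_cons hL IH.
rewrite !big_nil; have := hL (-1) 0 0.
by rewrite scaler0 addr0 => ->; rewrite mulN1r addNr.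
Qed.

Lemma scalarZ (L : V -> R) k x : scalar L -> L (k *: x) = k * L x.
Proof. by move=> /(@scalar_sum L _ [:: tt] (fun=> k) (fun=> x)); rewrite !big_seq1. Qed.

Lemma scalarN (L : V -> R) x : scalar L -> L (- x) = - L x.
Proof. by move=> hL; rewrite -scaleN1r scalarZ// mulN1r. Qed.

(** The type [form] carries no linearity, so multilinearity is a separate property, derived below
    from adapted frames. *)
Definition bilinear_form (G : V -> V -> R) : Prop :=
  (forall y, scalar (G^~ y)) /\ (forall x, scalar (G x)).

Definition trilinear_form (T : V -> V -> V -> R) : Prop :=
  [/\ forall y z, scalar (fun x => T x y z),
      forall x z, scalar (fun y => T x y z) &
      forall x y, scalar (T x y)].

Definition form2 (a : form V 2) x y : R := a (tnth [tuple x; y]).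
Definition form3 (a : form V 3) x y z : R := a (tnth [tuple x; y; z]).

Lemma form3E (a : form V 3) (v : 'I_3 -> V) : a v = form3 a (v 0) (v 1) (v ord_max).
Proof.
rewrite /form3; congr a; apply/funext => i.
by case: i => [[|[|[|//]]] ?]; rewrite (tnth_nth 0) /=; congr v; apply: val_inj.
Qed.

Lemma vartheta_form3 (M : 'End(V)) (a : form V 3) (v : 'I_3 -> V) :
  vartheta M a v = - (form3 a (M (v 0)) (v 1) (v ord_max)
    + form3 a (v 0) (M (v 1)) (v ord_max) + form3 a (v 0) (v 1) (M (v ord_max))).
Proof. by rewrite /vartheta !big_ord_recl big_ord0 addr0 addrA !form3E. Qed.

(* F is an orthonormal basis for the inner product om x (J y). *)
Record unitary_frame (om : V -> V -> R) J F : Prop := UnitaryFrame {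
  uf_bil : bilinear_form om;
  uf_anti : forall x y, om x y = - om y x;
  uf_JJ : forall x, J (J x) = - x;
  uf_omJ : forall x y, om (J x) (J y) = om x y;
  uf_unit : om (F ord0) (J (F ord0)) = 1;
  uf_expand : forall x, x = \sum_a om x (J (F a)) *: F a }.

Section AdaptedFrame.
Variables f1 f2 f3 f4 f5 f6 : V.
Let X : 6.-tuple V := [tuple f1; f2; f3; f4; f5; f6].
Hypothesis basisX : basis_of fullv X.
Local Notation c k := (coord X (inord k%N)).

Lemma coord_frameE k m : (k < 6)%N -> (m < 6)%N -> c k (X`_m) = (k == m)%:R.
Proof.
move=> k6 m6; rewrite -[m in X`_m](inordK m6) coord_free ?(basis_free basisX)//.
by rewrite -val_eqE /= !inordK// eq_sym.
Qed.

Lemma frame_expand x :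
  x = c 0 x *: f1 + c 1 x *: f2 + c 2 x *: f3 + c 3 x *: f4 + c 4 x *: f5 + c 5 x *: f6.
Proof.
rewrite {1}(coord_basis basisX (memvf x)) !big_ord_recl big_ord0 addr0 !addrA.
congr (_ *: _ + _ *: _ + _ *: _ + _ *: _ + _ *: _ + _ *: _);
by congr (coord _ _ _); apply: val_inj; rewrite /= inordK.
Qed.

Lemma coord_frame_endo (M : 'End(V)) k x : c k (M x) =
  c 0 x * c k (M f1) + c 1 x * c k (M f2) + c 2 x * c k (M f3)
  + c 3 x * c k (M f4) + c 4 x * c k (M f5) + c 5 x * c k (M f6).
Proof. by rewrite {1}(frame_expand x) !linearD !linearZ. Qed.

Lemma frame_coordE :
  ((c 0 f1 = 1) * (c 0 f2 = 0) * (c 0 f3 = 0) * (c 0 f4 = 0) * (c 0 f5 = 0) * (c 0 f6 = 0)) *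
  ((c 1 f1 = 0) * (c 1 f2 = 1) * (c 1 f3 = 0) * (c 1 f4 = 0) * (c 1 f5 = 0) * (c 1 f6 = 0)) *
  ((c 2 f1 = 0) * (c 2 f2 = 0) * (c 2 f3 = 1) * (c 2 f4 = 0) * (c 2 f5 = 0) * (c 2 f6 = 0)) *
  ((c 3 f1 = 0) * (c 3 f2 = 0) * (c 3 f3 = 0) * (c 3 f4 = 1) * (c 3 f5 = 0) * (c 3 f6 = 0)) *
  ((c 4 f1 = 0) * (c 4 f2 = 0) * (c 4 f3 = 0) * (c 4 f4 = 0) * (c 4 f5 = 1) * (c 4 f6 = 0)) *
  ((c 5 f1 = 0) * (c 5 f2 = 0) * (c 5 f3 = 0) * (c 5 f4 = 0) * (c 5 f5 = 0) * (c 5 f6 = 1)).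
Proof.
have E m k : (m < 6)%N -> (k < 6)%N -> c k X`_m = (k == m)%:R.
  by move=> m6 k6; exact: coord_frameE.
have E1 k : (k < 6)%N -> c k f1 = (k == 0)%N%:R := @E 0 k isT.
have E2 k : (k < 6)%N -> c k f2 = (k == 1)%N%:R := @E 1 k isT.
have E3 k : (k < 6)%N -> c k f3 = (k == 2)%N%:R := @E 2 k isT.
have E4 k : (k < 6)%N -> c k f4 = (k == 3)%N%:R := @E 3 k isT.
have E5 k : (k < 6)%N -> c k f5 = (k == 4)%N%:R := @E 4 k isT.
have E6 k : (k < 6)%N -> c k f6 = (k == 5)%N%:R := @E 5 k isT.
by rewrite !E1// !E2// !E3// !E4// !E5// !E6.
Qed.

Section Forms.
Variables (om : form V 2) (rho : form V 3) (J : 'End(V)).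
Hypothesis adapted : SU3_adapted om rho X.
Hypotheses (J1 : J f1 = f2 /\ J f2 = - f1) (J3 : J f3 = f4 /\ J f4 = - f3)
  (J5 : J f5 = f6 /\ J f6 = - f5).

Lemma coord_frameJ x :
  (c 0 (J x) = - c 1 x) * (c 1 (J x) = c 0 x) * (c 2 (J x) = - c 3 x) *
  (c 3 (J x) = c 2 x) * (c 4 (J x) = - c 5 x) * (c 5 (J x) = c 4 x).
Proof.
have [[J1a J1b] [J3a J3b] [J5a J5b]] := And3 J1 J3 J5.
have cN k y : c k (- y) = - c k y by rewrite linearN.
by rewrite !(coord_frame_endo J _ x) J1a J1b J3a J3b J5a J5b !cN !frame_coordE;
  do !split; ring.
Qed.

Lemma adapted_form2E x y : form2 om x y =
  c 0 x * c 1 y - c 0 y * c 1 x + (c 2 x * c 3 y - c 2 y * c 3 x)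
  + (c 4 x * c 5 y - c 4 y * c 5 x).
Proof.
have [_ -> _] := adapted.
by rewrite /form2 /= !fctE !mono2E.
Qed.

Lemma adapted_form3E x y z : form3 rho x y z =
  let m i j k := c i x * (c j y * c k z - c j z * c k y)
    - c i y * (c j x * c k z - c j z * c k x)
    + c i z * (c j x * c k y - c j y * c k x) in
  - m 1%N 3%N 5%N + m 0%N 2%N 5%N + m 0%N 3%N 4%N + m 1%N 2%N 4%N.
Proof.
have [_ _ ->] := adapted.
by rewrite /form3 /= !fctE !mono3E.
Qed.

Lemma adapted_unitary : unitary_frame (form2 om) J (fun a => X`_a).
Proof.
have cN k y : c k (- y) = - c k y by rewrite linearN.
have cP k a x y : c k (a *: x + y) = a * c k x + c k y by rewrite linearP.
have [[J1a J1b] [J3a J3b] [J5a J5b]] := And3 J1 J3 J5.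
split.
- by split=> [y a x x'|x a y y'] /=; rewrite !adapted_form2E !cP; ring.
- by move=> x y; rewrite !adapted_form2E; ring.
- move=> x; rewrite [LHS]frame_expand [in RHS](frame_expand x) !coord_frameJ.
  by rewrite !scaleNr !opprD.
- by move=> x y; rewrite !adapted_form2E !coord_frameJ; ring.
- by rewrite /= J1a adapted_form2E !frame_coordE; ring.
- move=> x; rewrite !big_ord_recl big_ord0 addr0 /= J1a J1b J3a J3b J5a J5b.
  rewrite [LHS]frame_expand !adapted_form2E !cN !frame_coordE !addrA.
  by congr (_ *: _ + _ *: _ + _ *: _ + _ *: _ + _ *: _ + _ *: _); ring.
Qed.

Lemma adapted_trilinear : trilinear_form (form3 rho).
Proof.
have cP k a x y : c k (a *: x + y) = a * c k x + c k y by rewrite linearP.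
by split=> [y z a x x'|x z a y y'|x y a z z'] /=; rewrite !adapted_form3E /= !cP; ring.
Qed.

(** This is the matrix of the contraction of rho with x. Each coordinate of x fills exactly four
    entries, up to sign. *)
Lemma adapted_form3_table x (a b : 'I_6) : form3 rho x X`_a X`_b =
  nth 0 (nth [::]
   [:: [:: 0; 0; c 5 x; c 4 x; - c 3 x; - c 2 x];
      [:: 0; 0; c 4 x; - c 5 x; - c 2 x; c 3 x];
      [:: - c 5 x; - c 4 x; 0; 0; c 1 x; c 0 x];
      [:: - c 4 x; c 5 x; 0; 0; c 0 x; - c 1 x];
      [:: c 3 x; c 2 x; - c 1 x; - c 0 x; 0; 0];
      [:: c 2 x; - c 3 x; - c 0 x; c 1 x; 0; 0]] a) b.
Proof.
rewrite adapted_form3E; cbv beta zeta; do ! rewrite [c _ X`_a]coord_frameE//.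
do ! rewrite [c _ X`_b]coord_frameE//.
by case: a b => [[|[|[|[|[|[|//]]]]]] _] [[|[|[|[|[|[|//]]]]]] _] /=; ring.
Qed.

(** The complex volume form is complex trilinear, so two factors J contribute i ^ 2 = -1. *)
Lemma adapted_form3J x y z : form3 rho x (J y) (J z) = - form3 rho x y z.
Proof. by rewrite !adapted_form3E /= !coord_frameJ; ring. Qed.

(** Moving both J off the second factor leaves the entrywise product of two tables, in which every
    coordinate product occurs four times; hence the factor 1/4. With J kept there, the sum is a
    contraction with the inverse of om and can change frame. *)
Lemma adapted_metricE x y : form2 om x (J y) =
  - 4^-1 * \sum_(a < 6) \sum_(b < 6)
    form3 rho x X`_a X`_b * form3 rho y (J X`_a) (J X`_b).
Proof.
under eq_bigr do under eq_bigr do rewrite adapted_form3J !adapted_form3_table.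
rewrite !big_ord_recl !big_ord0 /= adapted_form2E !coord_frameJ.
by field.
Qed.

Section DiagonalAction.
Variables (A : 'End(V)) (l1 l2 l3 : R).
Hypotheses (A1 : A f1 = l1 *: f2 /\ A f2 = - l1 *: f1)
  (A3 : A f3 = l2 *: f4 /\ A f4 = - l2 *: f3)
  (A5 : A f5 = l3 *: f6 /\ A f6 = - l3 *: f5).

Lemma coord_frameA x :
  (c 0 (A x) = - l1 * c 1 x) * (c 1 (A x) = l1 * c 0 x) *
  (c 2 (A x) = - l2 * c 3 x) * (c 3 (A x) = l2 * c 2 x) *
  (c 4 (A x) = - l3 * c 5 x) * (c 5 (A x) = l3 * c 4 x).
Proof.
have [[A1a A1b] [A3a A3b] [A5a A5b]] := And3 A1 A3 A5.
have cZ k m y : c k (m *: y) = m * c k y by rewrite linearZ.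
by rewrite !(coord_frame_endo A _ x) A1a A1b A3a A3b A5a A5b !cZ !frame_coordE;
  do !split; ring.
Qed.

Lemma adapted_skew x y : form2 om (A x) y = - form2 om x (A y).
Proof. by rewrite !adapted_form2E !coord_frameA; ring. Qed.

Lemma adapted_commute x : A (J x) = J (A x).
Proof.
rewrite [LHS]frame_expand [in RHS](frame_expand (J (A x))).
rewrite !(coord_frameA, coord_frameJ).
by congr (_ *: _ + _ *: _ + _ *: _ + _ *: _ + _ *: _ + _ *: _); ring.
Qed.

(* rho is the imaginary part of a complex volume form, on which A acts
   through its complex trace. *)
Lemma adapted_action x y z :
  form3 rho (A x) y z + form3 rho x (A y) z + form3 rho x y (A z) =
  (l1 + l2 + l3) * form3 rho (J x) y z.
Proof. by rewrite !adapted_form3E /= !coord_frameA !coord_frameJ; ring. Qed.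

(** Here [- A] stands for the adjoint of the skew map A. Each derivation contributes a factor l and
    one J in the first slot. *)
Lemma vartheta_square k v :
  vartheta A (vartheta (- A) (k *: rho)) v = (l1 + l2 + l3) ^+ 2 * (k * rho v).
Proof.
set l := l1 + l2 + l3.
have [t1 t2 t3] := adapted_trilinear.
have S x y z : form3 (vartheta (- A) (k *: rho)) x y z = k * (l * form3 rho (J x) y z).
  rewrite {1}/form3 vartheta_form3 !(tnth_nth 0) /= !opp_lfunE.
  rewrite -adapted_action.
  have E a b c : form3 (k *: rho) a b c = k * form3 rho a b c by [].
  rewrite !E (scalarN _ (t1 _ _)) (scalarN _ (t2 _ _)) (scalarN _ (t3 _ _)); ring.
(* Commuting A past J makes the sum the action of A at (J x, y, z); J ^ 2 = -1 then cancels the sign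
   of the outer [vartheta]. *)
rewrite vartheta_form3 !S -adapted_commute -!mulrDr adapted_action -/l.
rewrite (uf_JJ adapted_unitary) (scalarN _ (t1 _ _)).
rewrite -form3E; ring.
Qed.

End DiagonalAction.
End Forms.
End AdaptedFrame.
End Frames.

(** * The coflow as an ordinary differential equation *)

Section FrameIndependence.
Context {R : realType} {V : vectType R}.
Implicit Types (J : 'End(V)) (F E : 'I_6 -> V) (G : V -> V -> R).

Lemma form3K (a : form V 3) : a = fun v => form3 a (v 0) (v 1) (v ord_max).
Proof. by apply/funext => v; exact: form3E. Qed.

(** This gathers all that the uniqueness argument takes from an SU(3)-structure. *)
Lemma SU3_structure_frame om (rho : form V 3) J : SU3_structure om rho J ->
  exists F : 'I_6 -> V, [/\ unitary_frame (form2 om) J F,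
    trilinear_form (form3 rho) &
    forall x y, form2 om x (J y) =
      - 4^-1 * \sum_a \sum_b
        form3 rho x (F a) (F b) * form3 rho y (J (F a)) (J (F b))].
Proof.
move=> [f1 [f2 [f3 [f4 [f5 [f6 [ad J1 J3 J5]]]]]]].
have [bX _ _] := ad.
exists (fun a => [tuple f1; f2; f3; f4; f5; f6]`_a); split.
- exact: (adapted_unitary bX ad).
- exact: (adapted_trilinear ad).
- exact: (adapted_metricE bX ad).
Qed.

(* Both sides pair G with the inverse bivector of om. *)
Lemma frame_trace (om : V -> V -> R) J F J' E G : unitary_frame om J F -> unitary_frame om J' E ->
  bilinear_form G -> \sum_a G (F a) (J (F a)) = \sum_b G (E b) (J' (E b)).
Proof.
move=> hF hE [Gl Gr].
have GlN x y : G (- x) y = - G x y by exact: (scalarN (L := G^~ y)).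
(* Since om (K x) (K y) = om x y, the coefficients of K (H b) in H are om (H b) (H a), antisymmetric
   in a and b; so moving K to the other slot changes the sign. *)
have skew H (K : 'End(V)) : unitary_frame om K H ->
    \sum_b G (K (H b)) (H b) = - \sum_b G (H b) (K (H b)).
  move=> hH.
  have KH b : K (H b) = \sum_a om (H b) (H a) *: H a.
    by rewrite [LHS](uf_expand hH); apply: eq_bigr => a _; rewrite (uf_omJ hH).
  under eq_bigr do rewrite KH (scalar_sum _ _ _ (Gl _)).
  under [in RHS]eq_bigr do rewrite KH (scalar_sum _ _ _ (Gr _)).
  rewrite -sumrN exchange_big; apply: eq_bigr => a _.
  by rewrite -sumrN; apply: eq_bigr => b _; rewrite (uf_anti hH) mulNr.
(* The mixed sum arises from expanding J (F a) in E, and equally, up to sign, from expanding J' (E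
   b) in F. *)
transitivity (\sum_b \sum_a om (J (F a)) (J' (E b)) * G (F a) (E b)).
  rewrite exchange_big; apply: eq_bigr => a _.
  by rewrite {1}(uf_expand hE (J (F a))) (scalar_sum _ _ _ (Gr _)).
transitivity (- \sum_b G (J' (E b)) (E b)); last by rewrite skew// opprK.
rewrite -sumrN; apply: eq_bigr => b _.
rewrite [in RHS](uf_expand hF (J' (E b))) (scalar_sum _ _ _ (Gl _)) -sumrN.
by apply: eq_bigr => a _; rewrite (uf_anti hF) mulNr.
Qed.

(** The inner index passes to the new frame first, then the outer one, each time by
    [frame_trace]. *)
Lemma double_trace (om : V -> V -> R) J F J' E (T : V -> V -> V -> R) x y :
  unitary_frame om J F -> unitary_frame om J' E -> trilinear_form T ->
  \sum_a \sum_b T x (F a) (F b) * T y (J (F a)) (J (F b)) =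
  \sum_a \sum_b T x (E a) (E b) * T y (J' (E a)) (J' (E b)).
Proof.
move=> hF hE [_ T2 T3].
transitivity (\sum_a \sum_b T x (F a) (E b) * T y (J (F a)) (J' (E b))).
  apply: eq_bigr => a _.
  apply: (frame_trace (G := fun u v => T x (F a) u * T y (J (F a)) v) hF hE).
  split=> [v k u u'|u k v v'] /=.
    by rewrite (T3 x (F a)); ring.
  by rewrite (T3 y (J (F a))); ring.
rewrite exchange_big [RHS]exchange_big; apply: eq_bigr => b _ /=.
apply: (frame_trace (G := fun u v => T x u (E b) * T y v (J' (E b))) hF hE).
split=> [v k u u'|u k v v'] /=.
  by rewrite (T2 x (E b)); ring.
by rewrite (T2 y (J' (E b))); ring.
Qed.

End FrameIndependence.

(** * Complex structure, scale and adjoint as functions of the 3-form *)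

Section Flow.
Context {R : realType} {V : vectType R}.
Variables (om : V -> V -> R) (J0 A : 'End(V)) (E : 'I_6 -> V).
Hypothesis frameE : unitary_frame om J0 E.
Hypothesis A_om : forall x y, om (A x) y = - om x (A y).
Implicit Types (T : V -> V -> V -> R).

(* If eps * T is the 3-form of an SU(3)-structure compatible with om, then its
   complex structure is eps ^ 2 times this quadratic expression in T. *)
Definition cplx T (y : V) : V :=
  \sum_a (4^-1 * \sum_b \sum_c
    T (J0 (E a)) (E b) (E c) * T y (J0 (E b)) (J0 (E c))) *: E a.

(** If J = eps ^ 2 [cplx T], then J ^ 2 = -1 makes the square of [cplx T] equal to - eps ^ (-4);
    this component of it along E 0 reads off eps ^ (-4). *)
Definition quartic T : R := - om (cplx T (cplx T (E ord0))) (J0 (E ord0)).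

(** This is J A J with J = eps ^ 2 [cplx T] and eps ^ 4 replaced by the inverse quartic. *)
Definition coflow_adj T (y : V) : V := (quartic T)^-1 *: cplx T (A (cplx T y)).

(** The operator [vartheta] for a bare map, since [coflow_adj T] is not packaged as an
    endomorphism. *)
Definition vth (M : V -> V) (a : form V 3) : form V 3 :=
  fun v => - \sum_(i < 3) a (fun j => if j == i then M (v j) else v j).

Definition coflow_field T : form V 3 := fun v =>
  - (Num.sqrt (quartic T))^-1 *
  vth A (vth (coflow_adj T) (fun v => T (v 0) (v 1) (v ord_max))) v.

Lemma cplxZ T k y : trilinear_form T -> cplx T (k *: y) = k *: cplx T y.
Proof.
move=> [T1 _ _]; rewrite /cplx scaler_sumr; apply: eq_bigr => a _.
rewrite scalerA; congr (_ *: _); rewrite mulrCA; congr (_ * _).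
rewrite mulr_sumr; apply: eq_bigr => b _; rewrite mulr_sumr; apply: eq_bigr => c _.
by rewrite (scalarZ _ _ (T1 _ _)) mulrCA.
Qed.

Section At.
Variables (T : V -> V -> V -> R) (eps : R) (J B : 'End(V)) (F : 'I_6 -> V).
Hypotheses (eps0 : 0 < eps) (triT : trilinear_form T).
Hypothesis frameF : unitary_frame om J F.
Hypothesis metricJ : forall x y, om x (J y) =
  - 4^-1 * \sum_a \sum_b
    (eps * T x (F a) (F b)) * (eps * T y (J (F a)) (J (F b))).

(** The coordinate om (J y) (J0 (E a)) is minus the metric at (J0 (E a), y), which [metricJ] writes
    as a double sum over F; [double_trace] replaces F by the fixed frame E. *)
Lemma complex_structureE y : J y = eps ^+ 2 *: cplx T y.
Proof.
rewrite [LHS](uf_expand frameE) /cplx scaler_sumr; apply: eq_bigr => a _.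
rewrite scalerA; congr (_ *: _); rewrite (uf_anti frameE) metricJ.
rewrite mulNr opprK mulrCA; congr (_ * _).
rewrite -(double_trace _ _ frameF frameE triT) mulr_sumr.
apply: eq_bigr => b _; rewrite mulr_sumr; apply: eq_bigr => c _; ring.
Qed.

Lemma quarticE : eps ^+ 4 * quartic T = 1.
Proof.
have [/(_ (J0 (E ord0))) oml _] := uf_bil frameE.
have := uf_JJ frameF (E ord0).
rewrite !complex_structureE cplxZ// scalerA => /(congr1 (fun x => om x (J0 (E ord0)))).
rewrite (scalarZ _ _ oml) (scalarN _ oml) (uf_unit frameE) => h.
by rewrite /quartic mulrN -[RHS]opprK -h -exprD.
Qed.

Lemma quartic_gt0 : 0 < quartic T.
Proof.
have e4 : 0 < eps ^+ 4 by rewrite exprn_gt0.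
by rewrite -(pmulr_rgt0 _ e4) quarticE.
Qed.

Lemma epsE : eps = Num.sqrt (Num.sqrt (quartic T))^-1.
Proof.
have e2 : 0 <= eps ^+ 2 by rewrite sqr_ge0.
have -> : quartic T = (eps ^+ 2)^-1 ^+ 2.
  apply: (mulfI (x := eps ^+ 4)); first by rewrite gt_eqF ?exprn_gt0.
  by rewrite quarticE; field; rewrite gt_eqF.
by rewrite sqrtr_sqr ger0_norm ?invr_ge0// invrK sqrtr_sqr ger0_norm// ltW.
Qed.

Lemma eps2E : eps ^+ 2 = (Num.sqrt (quartic T))^-1.
Proof. by rewrite {1}epsE sqr_sqrtr// invr_ge0 sqrtr_ge0. Qed.

(** Adjointness reads om (A x) (J y) = om x (J (B y)), and A is skew for om, so J B = - A J and B =
    J A J. *)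
Lemma adjointE : adjoint_wrt (fun x y => om x (J y)) A B -> (B : V -> V) = coflow_adj T.
Proof.
move=> adjB; have [oml omr] := uf_bil frameE.
have JB y : J (B y) = - A (J y).
  apply/eqP; rewrite -subr_eq0 opprK; apply/eqP.
  rewrite [LHS](uf_expand frameE) big1// => a _.
  rewrite (uf_anti frameE) (_ : om _ _ = 0) ?oppr0 ?scale0r//.
  have := omr (J0 (E a)) 1 (J (B y)) (A (J y)); rewrite !mul1r scale1r => ->.
  by rewrite -adjB A_om addNr.
apply/funext => y; rewrite /coflow_adj.
have -> : B y = - J (J (B y)) by rewrite (uf_JJ frameF) opprK.
rewrite JB linearN /= opprK.
rewrite !complex_structureE [A _]linearZ /= cplxZ// scalerA -exprD.
congr (_ *: _); apply: (mulIf (x := quartic T)); first by rewrite gt_eqF ?quartic_gt0.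
by rewrite quarticE mulVf// gt_eqF ?quartic_gt0.
Qed.

End At.
End Flow.

(** This is how the components of the two solutions enter the class; compactness supplies the
    uniform bounds. *)
Lemma lipclose_continuous (R : realType) (a b : R) (d f g : R -> R) : a <= b ->
  (forall t, 0 <= d t) ->
  (forall t, a <= t <= b -> {for t, continuous f}) ->
  (forall t, a <= t <= b -> {for t, continuous g}) ->
  (forall t, a <= t <= b -> `|f t - g t| <= d t) -> lipclose a b d f g.
Proof.
move=> ab d0 cf cg fg.
have bnd (k : R -> R) : (forall t, a <= t <= b -> {for t, continuous k}) ->
    exists2 M, 0 <= M & forall t, a <= t <= b -> `|k t| <= M.
  move=> ck.
  have /(EVT_max ab)[c _ kc] : {within `[a, b], continuous (fun t => `|k t|)}.
    apply: continuous_in_subspaceT => t; rewrite inE /= in_itv /= => /ck kt.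
    by apply: continuous_comp kt _; exact: norm_continuous.
  by exists `|k c| => // t tab; apply: kc; rewrite in_itv.
have [M M0 fM] := bnd f cf; have [N N0 gN] := bnd g cg.
split=> //; exists (1 + M + N); first by rewrite !addr_ge0.
move=> t tab; split.
- by rewrite (le_trans (fM t tab))// addrAC lerDr addr_ge0.
- by rewrite (le_trans (gN t tab))// lerDr addr_ge0.
- by rewrite (le_trans (fg t tab))// ler_peMl// -addrA lerDl addr_ge0.
Qed.

Lemma is_derive_bigsum (R : realType) (I : Type) (r : seq I) (f : I -> R -> R)
    (df : I -> R) (t : R) : (forall i, is_derive t 1 (f i) (df i)) ->
  is_derive t 1 (fun s => \sum_(i <- r) f i s) (\sum_(i <- r) df i).
Proof.
move=> fdf; elim: r => [|i r IH].
  rewrite big_nil; have := is_derive_cst (0 : R) t 1; congr is_derive.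
  by apply/funext => s; rewrite big_nil.
rewrite big_cons; have := is_deriveD (fdf i) IH; congr is_derive.
by apply/funext => s; rewrite big_cons.
Qed.

(** * Lipschitz dependence of the flow field on the 3-form *)

Section FieldLipschitz.
Context {R : realType} {V : vectType R}.
Variables (om : V -> V -> R) (J0 A : 'End(V)) (E : 'I_6 -> V).
Hypothesis frameE : unitary_frame om J0 E.

(** The trilinear extension of the values of T on E: it expresses T through 216 numbers, the only
    data on which closeness is assumed. *)
Definition tri (T : V -> V -> V -> R) x y z : R :=
  \sum_a \sum_b \sum_c om x (J0 (E a)) * om y (J0 (E b)) * om z (J0 (E c)) *
    T (E a) (E b) (E c).

Lemma triE T : trilinear_form T -> tri T = T.
Proof.
move=> [T1 T2 T3]; apply/funext => x; apply/funext => y; apply/funext => z.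
rewrite {2}(uf_expand frameE x) (scalar_sum _ _ _ (T1 _ _)); apply: eq_bigr => a _.
rewrite {2}(uf_expand frameE y) (scalar_sum _ _ _ (T2 _ _)) mulr_sumr; apply: eq_bigr => b _.
rewrite {2}(uf_expand frameE z) (scalar_sum _ _ _ (T3 _ _)) !mulr_sumr; apply: eq_bigr => c _.
by rewrite !mulrA.
Qed.

Variables (a b : R) (d : R -> R).
Hypotheses (ab : a <= b) (d_ge0 : forall t, 0 <= d t).

(** Testing against linear functionals avoids choosing a norm on V. *)
Definition vlipclose (X Y : R -> V) : Prop :=
  forall L : V -> R, scalar L -> lipclose a b d (L \o X) (L \o Y).

Lemma vlipclose_cst x : vlipclose (cst x) (cst x).
Proof. by move=> L _; exact: (lipclose_cst a b d_ge0 (L x)). Qed.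

Lemma vlipclose_lin (M : 'End(V)) X Y : vlipclose X Y ->
  vlipclose (fun t => M (X t)) (fun t => M (Y t)).
Proof.
move=> XY L hL; apply: (XY (L \o M)) => k x y.
by rewrite /= linearP hL.
Qed.

Lemma vlipcloseZ f g X Y : lipclose a b d f g -> vlipclose X Y ->
  vlipclose (fun t => f t *: X t) (fun t => g t *: Y t).
Proof.
move=> fg XY L hL; have := lipcloseM fg (XY L hL).
by congr lipclose; apply/funext => t; rewrite /= scalarZ.
Qed.

Lemma vlipclose_sum (I : Type) (r : seq I) (X Y : I -> R -> V) :
  (forall i, vlipclose (X i) (Y i)) ->
  vlipclose (fun t => \sum_(i <- r) X i t) (fun t => \sum_(i <- r) Y i t).
Proof.
move=> XY L hL.
have := lipclose_sum d_ge0 r (P := xpredT) (fun i _ => XY i L hL).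
have LS (Z : I -> V) : L (\sum_(i <- r) Z i) = \sum_(i <- r) L (Z i).
  rewrite -[in RHS](eq_bigr _ (fun i _ => mul1r (L (Z i)))) -scalar_sum//.
  by under [in RHS]eq_bigr do rewrite scale1r.
by congr lipclose; apply/funext => t /=; rewrite LS.
Qed.

Variables T1 T2 : R -> V -> V -> V -> R.
Hypothesis T12 : forall i j k, lipclose a b d
  (fun t => T1 t (E i) (E j) (E k)) (fun t => T2 t (E i) (E j) (E k)).

Lemma tri_lipclose X1 X2 Y1 Y2 Z1 Z2 :
  vlipclose X1 X2 -> vlipclose Y1 Y2 -> vlipclose Z1 Z2 ->
  lipclose a b d (fun t => tri (T1 t) (X1 t) (Y1 t) (Z1 t))
                 (fun t => tri (T2 t) (X2 t) (Y2 t) (Z2 t)).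
Proof.
move=> X12 Y12 Z12; have [oml _] := uf_bil frameE.
apply: lipclose_sum => // i _; apply: lipclose_sum => // j _.
apply: lipclose_sum => // k _.
apply: lipcloseM => //; apply: lipcloseM => //; last exact: Z12 (oml _).
apply: lipcloseM => //; [exact: X12 (oml _)|exact: Y12 (oml _)].
Qed.

Lemma cplx_lipclose Y1 Y2 : vlipclose Y1 Y2 ->
  vlipclose (fun t => cplx J0 E (tri (T1 t)) (Y1 t))
            (fun t => cplx J0 E (tri (T2 t)) (Y2 t)).
Proof.
move=> Y12; apply: vlipclose_sum => i; apply: vlipcloseZ; last exact: vlipclose_cst.
apply: lipcloseM => //; first exact: lipclose_cst.
apply: lipclose_sum => // j _; apply: lipclose_sum => // k _.
by apply: lipcloseM => //; apply: tri_lipclose => //; exact: vlipclose_cst.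
Qed.

Local Notation Q T := (quartic om J0 E (tri T)).

Lemma quartic_lipclose : lipclose a b d (fun t => Q (T1 t)) (fun t => Q (T2 t)).
Proof.
have [oml _] := uf_bil frameE.
apply: lipcloseN => //.
have := cplx_lipclose (cplx_lipclose (vlipclose_cst (E ord0))).
by move=> /(_ _ (oml (J0 (E ord0)))).
Qed.

Hypotheses (Q1_gt0 : forall t, a <= t <= b -> 0 < Q (T1 t))
           (Q2_gt0 : forall t, a <= t <= b -> 0 < Q (T2 t)).

Lemma coflow_adj_lipclose Y1 Y2 : vlipclose Y1 Y2 ->
  vlipclose (fun t => coflow_adj om J0 A E (tri (T1 t)) (Y1 t))
            (fun t => coflow_adj om J0 A E (tri (T2 t)) (Y2 t)).
Proof.
move=> Y12; apply: vlipcloseZ; first by apply: lipcloseV => //; exact: quartic_lipclose.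
by apply: cplx_lipclose; apply: vlipclose_lin; exact: cplx_lipclose.
Qed.

Lemma coflow_field_lipclose v :
  lipclose a b d (fun t => coflow_field om J0 A E (tri (T1 t)) v)
                 (fun t => coflow_field om J0 A E (tri (T2 t)) v).
Proof.
apply: lipcloseM => //.
  apply: lipcloseN => //; apply: lipcloseV => //.
  - by apply: lipclose_sqrt => //; exact: quartic_lipclose.
  - by move=> t tab; rewrite sqrtr_gt0 Q1_gt0.
  - by move=> t tab; rewrite sqrtr_gt0 Q2_gt0.
apply: lipcloseN => //; apply: lipclose_sum => // i _.
apply: lipcloseN => //; apply: lipclose_sum => // j _.
(* The k-th argument in the (i, j) term: the outer derivation puts A in slot i, then the inner one
   applies the adjoint in slot j. *)
pose w (B : V -> V) (k : 'I_3) : V :=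
  if k == j then B (if k == i then A (v k) else v k) else (if k == i then A (v k) else v k).
suff wl k : vlipclose (fun t => w (coflow_adj om J0 A E (tri (T1 t))) k)
                      (fun t => w (coflow_adj om J0 A E (tri (T2 t))) k).
  exact: tri_lipclose (wl 0) (wl 1) (wl ord_max).
rewrite /w; case: (k == j); last exact: vlipclose_cst.
by apply: coflow_adj_lipclose; exact: vlipclose_cst.
Qed.

End FieldLipschitz.

(** * Uniqueness *)

Section Uniqueness.
Context {R : realType} {V : vectType R}.
Variables (omega0 : form V 2) (psi0 : form V 3) (J0 A : 'End(V)) (E : 'I_6 -> V).
Local Notation om := (form2 omega0).
Hypothesis frameE : unitary_frame om J0 E.
Hypothesis A_om : forall x y, om (A x) y = - om x (A y).
Local Notation Q T := (quartic om J0 E T).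

(** The scale, J and B in the coflow are all determined by q t, which leaves an ordinary
    differential equation for q alone. *)
Lemma coflow_solution_ode I (q : R -> form V 3) (eps : R -> R) t :
  coflow_solution A omega0 psi0 I q eps -> I t ->
  [/\ trilinear_form (form3 (q t)), 0 < Q (form3 (q t)),
      eps t = Num.sqrt (Num.sqrt (Q (form3 (q t))))^-1 &
      forall v, is_derive t 1 (fun s => q s v)
                  (coflow_field om J0 A E (form3 (q t)) v)].
Proof.
move=> [_ _ _ _ /(_ t)] /[apply] -[eps0 [J [B [su3 adj dq]]]].
have [F [frameF tri_eq met]] := SU3_structure_frame su3.
have scale x y z : form3 (eps t *: q t) x y z = eps t * form3 (q t) x y z by [].
have triq : trilinear_form (form3 (q t)).
  have en : eps t != 0 by rewrite gt_eqF.
  by have [t1 t2 t3] := tri_eq; split=> [y z k x x'|x z k y y'|x y k z z'];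
    apply: (mulfI en); rewrite mulrDr mulrCA -!scale;
    [exact: t1|exact: t2|exact: t3].
have met' x y : om x (J y) = - 4^-1 * \sum_a \sum_b
    (eps t * form3 (q t) x (F a) (F b)) *
    (eps t * form3 (q t) y (J (F a)) (J (F b))) by exact: met.
split=> //.
- exact: (quartic_gt0 frameE eps0 triq frameF met').
- exact: (epsE frameE eps0 triq frameF met').
move=> v; have := dq v; congr is_derive.
rewrite (eps2E frameE eps0 triq frameF met') /coflow_field -form3K.
by rewrite -(adjointE frameE A_om eps0 triq frameF met' adj).
Qed.

(** Gronwall's inequality is applied to the sum D of squared differences of components in E, on the
    compact interval between 0 and t. *)
Lemma coflow_solution_agree I1 q1 eps1 I2 q2 eps2 t :
  coflow_solution A omega0 psi0 I1 q1 eps1 ->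
  coflow_solution A omega0 psi0 I2 q2 eps2 ->
  I1 t -> I2 t -> q1 t = q2 t /\ eps1 t = eps2 t.
Proof.
move=> s1 s2 I1t I2t.
suff q12 : q1 t = q2 t.
  have [_ _ -> _] := coflow_solution_ode s1 I1t.
  by have [_ _ -> _] := coflow_solution_ode s2 I2t; rewrite q12.
have [tri1 _ _ _] := coflow_solution_ode s1 I1t.
have [tri2 _ _ _] := coflow_solution_ode s2 I2t.
have [_ itv1 I10 q10 _] := s1; have [_ itv2 I20 q20 _] := s2.
pose idx := ('I_6 * 'I_6 * 'I_6)%type.
pose e (p : idx) : 'I_3 -> V := tnth [tuple E p.1.1; E p.1.2; E p.2].
pose u (q : R -> form V 3) p s : R := q s (e p).
pose D s : R := \sum_(p : idx) (u q1 p s - u q2 p s) ^+ 2.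
suff D0 : D t = 0.
  rewrite [q1 t]form3K [q2 t]form3K -(triE frameE tri1) -(triE frameE tri2).
  apply/funext => v; apply: eq_bigr => i _; apply: eq_bigr => j _.
  apply: eq_bigr => k _; congr (_ * _); apply/eqP; rewrite -subr_eq0.
  have /eqP := D0; rewrite psumr_eq0 => [|p _]; last exact: sqr_ge0.
  by move=> /allP /(_ (i, j, k)); rewrite mem_index_enum sqrf_eq0 => /(_ isT).
(* Both domains are intervals through 0 and t, so they contain [a, b]. *)
pose a : R := Num.min 0 t; pose b : R := Num.max 0 t.
have ab : a <= b by rewrite /a /b; case: (ltP 0 t) => [/ltW|].
have a0b : a <= 0 <= b by rewrite /a /b; case: (ltP 0 t) => [/ltW ->|->]; rewrite lexx.
have tab : a <= t <= b by rewrite /a /b; case: (ltP 0 t) => [/ltW ->|->]; rewrite lexx.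
have sub (I : set R) : is_interval I -> I 0 -> I t -> forall s, a <= s <= b -> I s.
  rewrite /a /b => itv h0 ht s; case: (ltP 0 t) => _ sI.
    exact: itv h0 ht _ sI.
  exact: itv ht h0 _ sI.
have {itv1 I10 I1t} in1 := sub _ itv1 I10 I1t.
have {itv2 I20 I2t} in2 := sub _ itv2 I20 I2t.
have ode1 s sab := coflow_solution_ode s1 (in1 s sab).
have ode2 s sab := coflow_solution_ode s2 (in2 s sab).
(* D is differentiable, while the Lipschitz bounds are in terms of d; they combine through d * d =
   D. *)
pose d s : R := Num.sqrt (D s).
have D_ge0 s : 0 <= D s by apply: sumr_ge0 => p _; exact: sqr_ge0.
have d_ge0 s : 0 <= d s by exact: sqrtr_ge0.
have led p s : `|u q1 p s - u q2 p s| <= d s.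
  rewrite -sqrtr_sqr ler_sqrt// /D (bigD1 p)//= lerDl.
  by apply: sumr_ge0 => ? _; exact: sqr_ge0.
have cont (s : R) (q : R -> form V 3) v (df : R) : is_derive s 1 (fun u => q u v) df ->
    {for s, continuous (fun u => q u v)}.
  move=> qd; apply: differentiable_continuous; apply/derivable1_diffP.
  exact: ex_derive.
have lip i j k : lipclose a b d (fun s => form3 (q1 s) (E i) (E j) (E k))
    (fun s => form3 (q2 s) (E i) (E j) (E k)).
  apply: lipclose_continuous => // s sab.
  - by have [_ _ _ dq] := ode1 s sab; exact: cont (dq _).
  - by have [_ _ _ dq] := ode2 s sab; exact: cont (dq _).
  - exact: (led (i, j, k)).
have Q1 s : a <= s <= b -> 0 < Q (tri om J0 E (form3 (q1 s))).
  by move=> sab; have [tr ? _ _] := ode1 s sab; rewrite triE.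
have Q2 s : a <= s <= b -> 0 < Q (tri om J0 E (form3 (q2 s))).
  by move=> sab; have [tr ? _ _] := ode2 s sab; rewrite triE.
pose f (q : R -> form V 3) s v : R := coflow_field om J0 A E (tri om J0 E (form3 (q s))) v.
have /choice[C hC] p : exists C, 0 <= C /\ forall s, a <= s <= b ->
    `|f q1 s (e p) - f q2 s (e p)| <= C * d s.
  have [_ _ [C C0 h]] := coflow_field_lipclose A frameE ab d_ge0 lip Q1 Q2 (e p).
  by exists C; split=> // s /h[].
apply: (gronwall_eq0 (D := D) (C := \sum_p 2 * C p)
  (D' := fun s => \sum_p 2 * (u q1 p s - u q2 p s) * (f q1 s (e p) - f q2 s (e p)))
  a0b _ _ D_ge0 _ tab).
- move=> s sab; apply: is_derive_bigsum => p.
  have [tr1 _ _ /(_ (e p)) d1] := ode1 s sab.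
  have [tr2 _ _ /(_ (e p)) d2] := ode2 s sab.
  have dB := is_deriveB d1 d2.
  have := is_deriveX 2 dB; congr is_derive.
  by rewrite /f !triE// /GRing.scale /= expr1.
- move=> s sab; rewrite (le_trans (ler_norm_sum _ _ _))// mulr_suml.
  apply: ler_sum => p _; have [C0 hCp] := hC p.
  rewrite !normrM ger0_norm// -!mulrA ler_wpM2l//.
  have -> : C p * D s = d s * (C p * d s).
    by rewrite -{1}(sqr_sqrtr (D_ge0 s)) -/(d s); ring.
  by rewrite ler_pM// hCp.
- by rewrite /D /u q10 q20 big1// => p _; rewrite subrr expr0n.
Qed.

End Uniqueness.

(** * The explicit solution *)

Section ExplicitSolution.
Context {R : realType}.
Implicit Types (l t : R).

(** The condition on the right covers l = 0 as well, where it always holds. *)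
Lemma lifetimeE l t : (t%:E < lifetime l)%E = (0 < 1 - 2 * l ^+ 2 * t).
Proof.
rewrite /lifetime; case: eqVneq => [->|l0].
  by rewrite ltry expr0n mulr0 mul0r subr0 ltr01.
have l2 : 0 < 2 * l ^+ 2 by rewrite mulr_gt0// exprn_even_gt0.
by rewrite lte_fin -[ltRHS]mul1r ltr_pdivlMr// subr_gt0 [t * _]mulrC.
Qed.

Lemma is_derive_log_affine (k s : R) : k != 0 -> 0 < 1 - k * s ->
  is_derive s 1 (fun u => - k^-1 * ln (1 - k * u)) (1 - k * s)^-1.
Proof.
move=> k0 s0.
have dg : is_derive s 1 (fun u : R => 1 - k * u) (- k).
  by apply: is_derive_eq; rewrite /GRing.scale /=; ring.
have dl := is_derive1_ln s0.
have dc := is_derive1_comp (f := @ln R) (g := fun u => 1 - k * u) dl dg.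
have := is_deriveZ (- k^-1) dc; congr is_derive.
by rewrite /GRing.scale /=; field; rewrite k0 gt_eqF.
Qed.

(** The integrand is prescribed only on [a, b], because [eps_sol] squared is the inverse affine
    function only while the radicand is positive. *)
Lemma Rintegral_inv_affine (k a b : R) (f : R -> R) : a < b -> k != 0 ->
  (forall u, a <= u <= b -> 0 < 1 - k * u) ->
  (forall u, a <= u <= b -> f u = (1 - k * u)^-1) ->
  Rintegral lebesgue_measure `[a, b] f =
    - k^-1 * ln (1 - k * b) + k^-1 * ln (1 - k * a).
Proof.
move=> ab k0 pos fE.
pose F (u : R) : R := - k^-1 * ln (1 - k * u).
have dF u : a <= u <= b -> is_derive u 1 F (1 - k * u)^-1.
  by move=> /pos; exact: is_derive_log_affine.
have cF u : a <= u <= b -> {for u, continuous F}.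
  move=> /dF dFu; apply: differentiable_continuous; apply/derivable1_diffP.
  exact: ex_derive.
have oc u : a < u < b -> a <= u <= b by move=> /andP[/ltW -> /ltW ->].
have := @continuous_FTC2 R f F a b ab.
have cf : {within `[a, b], continuous f}.
  have : {within `[a, b], continuous (fun u => (1 - k * u)^-1)}.
    apply: continuous_in_subspaceT => u; rewrite inE /= in_itv /= => /pos u0.
    apply: cvgV; first by rewrite gt_eqF.
    by apply: cvgB; [exact: cvg_cst|apply: cvgM; [exact: cvg_cst|exact: cvg_id]].
  apply: subspace_eq_continuous => u; rewrite inE /= in_itv /= => uab.
  exact: esym (fE u uab).
have LR : derivable_oo_LRcontinuous F a b.
  split.
  - by move=> u; rewrite in_itv /= => /oc/dF dFu; exact: ex_derive.
  - by apply: cvg_at_right_filter; apply: cF; rewrite lexx ltW.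
  - by apply: cvg_at_left_filter; apply: cF; rewrite lexx ltW.
have Ff : {in `]a, b[, derive1 F =1 f}.
  move=> u; rewrite in_itv /= => /oc uab; rewrite derive1E fE//.
  exact: (derive_val (is_derive := dF u uab)).
move=> /(_ cf LR Ff); rewrite /Rintegral => -> /=.
by rewrite /F !mulNr opprK.
Qed.

Lemma eps_sol_sqr l t : 0 < 1 - 2 * l ^+ 2 * t ->
  eps_sol l t ^+ 2 = (1 - 2 * l ^+ 2 * t)^-1.
Proof. by move=> t0; rewrite /eps_sol exprVn sqr_sqrtr// ltW. Qed.

(** With k = 2 l ^ 2 the integral is - ln (1 - k t) / k; multiplied by - l ^ 2 it becomes half the
    logarithm. The case l = 0 is separate because of the division by k. *)
Lemma b_solE l t : 0 < 1 - 2 * l ^+ 2 * t ->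
  b_sol l t = Num.sqrt (1 - 2 * l ^+ 2 * t).
Proof.
move=> t0; rewrite /b_sol; have [->|l0] := eqVneq l 0.
  by rewrite expr0n /= oppr0 mul0r expR0 mulr0 mul0r subr0 sqrtr1.
set k := 2 * l ^+ 2 in t0 *; have k0 : 0 < k by rewrite mulr_gt0// exprn_even_gt0.
have kn : k != 0 by rewrite gt_eqF.
have -> : oint 0 t (fun u => eps_sol l u ^+ 2) = - k^-1 * ln (1 - k * t).
  rewrite /oint; have [->|tn0] := eqVneq t 0.
    by rewrite lexx set_itv1 Rintegral_set1 mulr0 subr0 ln1 mulr0.
  case: (leP 0 t) => [t_ge0|t_lt0].
  - have t_gt0 : 0 < t by rewrite lt_neqAle eq_sym tn0.
    have pos u : 0 <= u <= t -> 0 < 1 - k * u.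
      move=> /andP[_ ut]; apply: lt_le_trans t0 _.
      by rewrite lerD2l lerN2 ler_wpM2l// ltW.
    rewrite (Rintegral_inv_affine (k := k))//.
      by rewrite mulr0 subr0 ln1 mulr0 addr0.
    by move=> u /pos; exact: eps_sol_sqr.
  - have pos u : t <= u <= 0 -> 0 < 1 - k * u.
      move=> /andP[_ u0]; rewrite subr_gt0; apply: le_lt_trans ltr01.
      by rewrite mulr_ge0_le0// ltW.
    rewrite (Rintegral_inv_affine (k := k))//.
      by rewrite mulr0 subr0 ln1 mulr0 add0r mulNr.
    by move=> u /pos; exact: eps_sol_sqr.
have s0 : 0 < Num.sqrt (1 - k * t) by rewrite sqrtr_gt0.
have -> : - l ^+ 2 * (- k^-1 * ln (1 - k * t)) = ln (Num.sqrt (1 - k * t)).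
  rewrite -{1}(sqr_sqrtr (ltW t0)) lnXn// -mulr_natl /k; field.
  by rewrite l0.
by rewrite lnK.
Qed.

Lemma near_lifetime l t : 0 < 1 - 2 * l ^+ 2 * t ->
  \forall s \near t, 0 < 1 - 2 * l ^+ 2 * s.
Proof.
move=> t0; have : {for t, continuous (fun s : R => 1 - 2 * l ^+ 2 * s)}.
  by apply: cvgB; [exact: cvg_cst|apply: cvgM; [exact: cvg_cst|exact: cvg_id]].
move=> cvg_t; exact: cvg_t _ (lt_nbhsr t0).
Qed.

(** The closed form holds where the radicand is positive, an open condition, so it can be
    differentiated in place of the integral. *)
Lemma is_derive_b_sol l t : 0 < 1 - 2 * l ^+ 2 * t ->
  is_derive t 1 (b_sol l) (- (eps_sol l t) ^+ 2 * l ^+ 2 * b_sol l t).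
Proof.
move=> t0.
apply: (near_eq_is_derive (f := fun s => Num.sqrt (1 - 2 * l ^+ 2 * s))).
  by near=> s; rewrite b_solE//; near: s; exact: near_lifetime.
have dg : is_derive t 1 (fun u : R => 1 - 2 * l ^+ 2 * u) (- (2 * l ^+ 2)).
  by apply: is_derive_eq; rewrite /GRing.scale /=; ring.
have ds := is_derive1_sqrt t0.
have := is_derive1_comp (f := Num.sqrt) (g := fun u => 1 - 2 * l ^+ 2 * u) ds dg.
congr is_derive.
rewrite b_solE// /eps_sol.
have : Num.sqrt (1 - 2 * l ^+ 2 * t) != 0 by rewrite gt_eqF// sqrtr_gt0.
by move: (Num.sqrt _) => s s0; field.
Unshelve. all: by end_near.
Qed.

End ExplicitSolution.

(** * Existence and maximality of the explicit solution *)

Section Solution.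
Context {R : realType} {V : vectType R}.
Variables (omega0 : form V 2) (psi0 : form V 3) (J0 A : 'End(V)).
Implicit Types (I : set R) (p q : R -> form V 3).

Lemma coflow_solutionS I I' p eps : open I' -> is_interval I' -> I' 0 -> I' `<=` I ->
  coflow_solution A omega0 psi0 I p eps -> coflow_solution A omega0 psi0 I' p eps.
Proof. by move=> oI' iI' I'0 I'I [_ _ _ p0 h]; split=> // t /I'I; exact: h. Qed.

Lemma lifetime_gt0 (l : R) : (0%:E < lifetime l)%E.
Proof. by rewrite lifetimeE mulr0 subr0. Qed.

Lemma lifetime_interval (l : R) (I := [set t : R | (t%:E < lifetime l)%E]) :
  open I /\ is_interval I.
Proof.
split=> [|x y _ Iy z /andP[_ zy]]; last by apply: le_lt_trans Iy; rewrite lee_fin.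
rewrite /I /lifetime; case: eqVneq => _.
  rewrite (_ : [set _ | _] = setT); first exact: openT.
  by apply/seteqP; split=> // t _ /=; rewrite ltry.
rewrite (_ : [set _ | _] = [set t | t < (2 * l ^+ 2)^-1]); first exact: open_lt.
by apply/seteqP; split=> t /=; rewrite lte_fin.
Qed.

Lemma coflow_solution_explicit (l : R) :
  (forall x, J0 (J0 x) = - x) ->
  SU3_structure omega0 psi0 J0 ->
  (forall x y, form2 omega0 (A x) y = - form2 omega0 x (A y)) ->
  bilinear_form (form2 omega0) ->
  (forall x, A (J0 x) = J0 (A x)) ->
  (forall k v, vartheta A (vartheta (- A) (k *: psi0)) v = l ^+ 2 * (k * psi0 v)) ->
  coflow_solution A omega0 psi0 [set t : R | (t%:E < lifetime l)%E]
    (fun t => b_sol l t *: psi0) (eps_sol l).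
Proof.
move=> JJ su3 A_om [_ omr] AJ AA; have [oI iI] := lifetime_interval l.
split=> //; first exact: lifetime_gt0.
  have t0 : 0 < 1 - 2 * l ^+ 2 * 0 by rewrite mulr0 subr0.
  by rewrite b_solE// mulr0 subr0 sqrtr1 scale1r.
move=> t; rewrite /= lifetimeE => t0.
have s0 : 0 < Num.sqrt (1 - 2 * l ^+ 2 * t) by rewrite sqrtr_gt0.
split; first by rewrite invr_gt0.
(* Since eps b = 1, the rescaled form is psi_0 at every time; the complex structure stays J_0 and
   the adjoint stays - A. *)
exists J0, (- A)%R; split.
- by rewrite scalerA b_solE// mulVf ?gt_eqF// scale1r.
- move=> x y; rewrite /SU3_metric opp_lfunE linearN /= -AJ.
  rewrite -[LHS]/(form2 omega0 (A x) (J0 y)) A_om.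
  by rewrite -[RHS]/(form2 omega0 x (- A (J0 y))) scalarN.
- move=> v; rewrite AA.
  have db := is_derive_b_sol t0.
  have := is_deriveZ (psi0 v) db; congr is_derive.
    by apply/funext => s; exact: mulrC.
  by rewrite /GRing.scale /=; ring.
Qed.

Lemma coflow_solution_ancient (l : R) p eps :
  coflow_solution A omega0 psi0 [set t : R | (t%:E < lifetime l)%E] p eps ->
  ancient_solution A omega0 psi0 p eps.
Proof.
move=> sol.
have [T [T0 TI]] : exists T : R, 0 < T /\ (T%:E <= lifetime l)%E.
  (* An ancient solution has a finite end-point; when the lifetime is infinite any positive number
     serves. *)
  rewrite /lifetime; case: eqVneq => [_|l0]; first by exists 1; rewrite leey.
  exists (2 * l ^+ 2)^-1; split=> //.
  by rewrite invr_gt0 mulr_gt0// exprn_even_gt0.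
exists T => //; apply: coflow_solutionS sol => //.
- by move=> x y _ yT z /andP[_ zy]; exact: le_lt_trans zy yT.
- by move=> t tT; apply: lt_le_trans TI; rewrite lte_fin.
Qed.

Variable E : 'I_6 -> V.
Hypothesis frameE : unitary_frame (form2 omega0) J0 E.
Hypothesis A_om : forall x y, form2 omega0 (A x) y = - form2 omega0 x (A y).

(** A solution defined past the lifetime would be defined at T = 1 / (2 l ^ 2), where continuity
    forces it to vanish, against positivity of the quartic. *)
Lemma coflow_solution_max (l : R) I q eps :
  coflow_solution A omega0 psi0 [set t : R | (t%:E < lifetime l)%E]
    (fun t => b_sol l t *: psi0) (eps_sol l) ->
  coflow_solution A omega0 psi0 I q eps ->
  I `<=` [set t : R | (t%:E < lifetime l)%E].
Proof.
move=> solp solq t It /=; rewrite ltNge; apply/negP => tI.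
have [l0 /= T0 TE] : [/\ l != 0, 0 < (2 * l ^+ 2)^-1 & lifetime l = ((2 * l ^+ 2)^-1)%:E].
  move: tI; rewrite /lifetime; case: eqVneq => [_|l0 _]; first by rewrite leye_eq.
  by split=> //; rewrite invr_gt0 mulr_gt0// exprn_even_gt0.
set T := (2 * l ^+ 2)^-1 in T0 TE.
have [_ itv I0 _ _] := solq.
have IT : I T.
  by apply: itv I0 It _ _; rewrite ltW//= -lee_fin -TE.
have [_ Q0 _ /(_ _)dq] := coflow_solution_ode frameE A_om solq IT.
have kT : 1 - 2 * l ^+ 2 * T = 0.
  by rewrite /T mulfV ?subrr// mulf_neq0// ?pnatr_eq0// expf_neq0.
(* From the left q s tends to q T, yet before T it equals b psi_0, and b tends to 0. *)
have qT v : q T v = 0.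
  have cq : q s v @[s --> T^'-] --> q T v.
    apply: cvg_at_left_filter; apply: differentiable_continuous.
    by apply/derivable1_diffP; have dqv := dq v; exact: ex_derive.
  have cp : Num.sqrt (1 - 2 * l ^+ 2 * s) * psi0 v @[s --> T^'-] --> (0 : R).
    rewrite -[X in _ --> X](mul0r (psi0 v)) -sqrtr0 -kT.
    apply: cvg_at_left_filter; apply: cvgM; last exact: cvg_cst.
    apply: (@continuous_comp _ _ _ (fun s : R => 1 - 2 * l ^+ 2 * s)).
      by apply: cvgB; [exact: cvg_cst|apply: cvgM; [exact: cvg_cst|exact: cvg_id]].
    exact: sqrt_continuous.
  apply: (norm_cvg_unique cq); apply: cvg_trans cp.
  apply: near_eq_cvg; near=> s.
  have s0 : 0 < s by near: s; exact: nbhs_left_gt.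
  have sT : s < T by near: s; exact: nbhs_left_lt.
  have sI : (s%:E < lifetime l)%E by rewrite TE lte_fin.
  have Is : I s by apply: (itv 0 T I0 IT s); rewrite !ltW.
  have [-> _] := coflow_solution_agree frameE A_om solq solp Is sI.
  by rewrite /= b_solE// -lifetimeE.
suff : quartic (form2 omega0) J0 E (form3 (q T)) = 0 by move=> Q00; rewrite Q00 ltxx in Q0.
rewrite /quartic (_ : cplx _ _ _ _ = 0).
  have [oml _] := uf_bil frameE.
  by have := scalarZ 0 0 (oml (J0 (E ord0))); rewrite scale0r mul0r => ->; rewrite oppr0.
rewrite /cplx big1// => a _; rewrite big1 ?mulr0 ?scale0r// => b _.
by rewrite big1// => c _; rewrite /form3 !qT mul0r.
Unshelve. all: by end_near.
Qed.

End Solution.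

Theorem theorem3p5 (R : realType) (g : vectType R) (br : g -> g -> g)
    (e7 : g) (h : {vspace g}) (A : 'End(subvs_of h))
    (phi0 : form g 3) (gphi0 : g -> g -> R) (dphi0 : form g 4)
    (J0 : 'End(subvs_of h)) (l1 l2 l3 : R) (e1 e2 e3 : subvs_of h) :
  let omega0 : form (subvs_of h) 2 := form_restr h (contract e7 phi0) in
  let psi0 : form (subvs_of h) 3 := form_restr h (contract e7 (- dphi0)) in
  let h0 : subvs_of h -> subvs_of h -> R :=
    fun x y => gphi0 (vsval x) (vsval y) in
  let l : R := l1 + l2 + l3 in
  let I : set R := [set t : R | (t%:E < lifetime l)%E] in
  let p : R -> form (subvs_of h) 3 := fun t => b_sol l t *: psi0 in
  \dim (fullv : {vspace g}) = 7%N ->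
  almost_abelian br e7 A ->
  G2_structure phi0 gphi0 dphi0 ->
  CE_diff br dphi0 = 0 ->
  gphi0 e7 e7 = 1 ->
  (forall v, v \in h -> gphi0 e7 v = 0) ->
  SU3_structure omega0 psi0 J0 ->
  (forall x y, h0 (A x) y = - h0 x (A y)) ->
  SU3_adapted omega0 psi0 [tuple e1; J0 e1; e2; J0 e2; e3; J0 e3] ->
  A e1 = l1 *: J0 e1 /\ A (J0 e1) = - l1 *: e1 ->
  A e2 = l2 *: J0 e2 /\ A (J0 e2) = - l2 *: e2 ->
  A e3 = l3 *: J0 e3 /\ A (J0 e3) = - l3 *: e3 ->
  [/\ coflow_solution A omega0 psi0 I p (eps_sol l),
      (forall (I' : set R) (q : R -> form (subvs_of h) 3) (eps : R -> R),
         coflow_solution A omega0 psi0 I' q eps ->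
         I' `<=` I /\
         forall t, I' t -> q t = p t /\ eps t = eps_sol l t) &
      ancient_solution A omega0 psi0 p (eps_sol l)].
Proof.
move=> omega0 psi0 h0 l I p _ _ _ _ _ _ su3 _ ad A1 A2 A3.
(* J_0 comes from an adapted frame that may differ from the e_j; J_0 ^ 2 = -1 is what makes it the
   complex structure of the frame e_j, J_0 e_j too. *)
have JJ x : J0 (J0 x) = - x.
  by have [F [frameF _ _]] := SU3_structure_frame su3; exact: uf_JJ frameF x.
have [bX _ _] := ad.
have frame := adapted_unitary bX ad
  (conj erefl (JJ e1)) (conj erefl (JJ e2)) (conj erefl (JJ e3)).
have A_om := adapted_skew bX ad A1 A2 A3.
have AJ := adapted_commute bX
  (conj erefl (JJ e1)) (conj erefl (JJ e2)) (conj erefl (JJ e3)) A1 A2 A3.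
have AA := vartheta_square bX ad
  (conj erefl (JJ e1)) (conj erefl (JJ e2)) (conj erefl (JJ e3)) A1 A2 A3.
have sol : coflow_solution A omega0 psi0 I p (eps_sol l).
  exact: coflow_solution_explicit JJ su3 A_om (uf_bil frame) AJ AA.
split=> //; last exact: coflow_solution_ancient sol.
move=> I' q eps solq.
have I'I := coflow_solution_max frame A_om sol solq.
split=> // t I't.
exact: (coflow_solution_agree frame A_om solq sol I't (I'I t I't)).
Qed.
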